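(* Let $q$ be any prime power, and let $m,n,\delta,y$ be positive integers with $\delta\leq y\leq\min\{m-\delta+2,\,n-\delta-1\}$. Let $0\le z_0\le z_1\le\cdots\le z_{y-\delta}\le y-\delta$ be integers, and let $\mathcal F$ be the $m\times n$ Ferrers diagram whose column counts are $\gamma_j=\delta-1$ for $0\le j\le n-y-1$; $\gamma_{n-y+i}=\delta-1+z_i$ for $0\le i\le y-\delta$; $\gamma_j=y-1$ for $n-\delta+1\le j\le n-2$; $\gamma_{n-1}=m$. (Equivalently: the first $\delta-1$ rows are full; rows $\delta-1,\dots,y-2$ contain, in columns $n-y,\dots,n-\delta$, a sub-diagram $\mathcal P$ whose $i$-th column has $z_i$ dots, and are full in the rightmost $\delta-1$ columns; rows $y-1,\dots,m-1$ contain only a dot in the last column.) Let $|\mathcal P|=\sum_{i=0}^{y-\delta}z_i$. If $z_0\leq n-y$, then there exists an optimal $[\mathcal F,k,\delta]_q$ code, where $k=m-y+1+(y-\delta)(\delta-1)+|\mathcal P|$ if $m-n\leq\delta-2$, and $k=n-1+(y-\delta)(\delta-2)+|\mathcal P|$ otherwise.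
   Context: $[a]$ denotes $\{0,1,\dots,a-1\}$; rows and columns of an $m\times n$ matrix are indexed by $[m]$ and $[n]$. An $m\times n$ Ferrers diagram is a set $\mathcal F\subseteq[m]\times[n]$ of cells (''dots'') such that: if $(i,j)\in\mathcal F$ and $i\ge1$ then $(i-1,j)\in\mathcal F$; if $(i,j)\in\mathcal F$ and $j\le n-2$ then $(i,j+1)\in\mathcal F$; row $0$ contains $n$ dots and column $n-1$ contains $m$ dots. $\gamma_j$ denotes the number of dots in column $j$. For an $m\times n$ Ferrers diagram $\mathcal F$, an $[\mathcal F,k,\delta]_q$ code is a $k$-dimensional $\mathbb F_q$-linear subspace $\mathcal C\subseteq\mathbb F_q^{m\times n}$ such that every matrix in $\mathcal C$ has zero entries in all positions not in $\mathcal F$, and every nonzero matrix of $\mathcal C$ has rank at least $\delta$. Such a code is called optimal if $k=\min_{i\in[\delta]}v_i$, where $v_i$ is the number of dots of $\mathcal F$ that lie neither in the first $i$ rows nor in the rightmost $\delta-1-i$ columns. *)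

(* Defs.v *)
From HB Require Import structures.
From mathcomp Require Import all_boot all_order all_algebra all_field.

Set Implicit Arguments.
Unset Strict Implicit.
Unset Printing Implicit Defensive.

Import GRing.Theory.

Section Diagrams.
Variables m n : nat.
Implicit Type D : {set 'I_m * 'I_n}.

Definition row_dots D (i : 'I_m) : nat := #|[set j | (i, j) \in D]|.

Definition col_dots D (j : 'I_n) : nat := #|[set i | (i, j) \in D]|.

Definition ferrers D : Prop :=
  [/\ forall (i i' : 'I_m) (j : 'I_n),
        i = i'.+1 :> nat -> (i, j) \in D -> (i', j) \in D,
      forall (i : 'I_m) (j j' : 'I_n),
        j' = j.+1 :> nat -> (i, j) \in D -> (i, j') \in D,
      forall i : 'I_m, i = 0 :> nat -> row_dots D i = n
    & forall j : 'I_n, j = n.-1 :> nat -> col_dots D j = m].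

(* The rightmost s columns are those of index j with n <= j + s. *)
Definition dots_outside D (delta i : nat) : nat :=
  #|[set c in D | (i <= c.1) && (c.2 + (delta - 1 - i) < n)]|.

(* The default value is the term of index 0, so that for 0 < delta this is
   the minimum over i < delta. *)
Definition min_dots_outside D (delta : nat) : nat :=
  \big[minn/dots_outside D delta 0]_(i < delta) dots_outside D delta i.

Section Codes.
Variable K : finFieldType.

Definition ferrers_code D (k delta : nat) (C : {vspace 'M[K]_(m, n)}) : Prop :=
  [/\ \dim C = k,
      forall A : 'M[K]_(m, n), A \in C ->
        forall i j, (i, j) \notin D -> A i j = 0%R
    & forall A : 'M[K]_(m, n), A \in C -> A != 0%R -> delta <= \rank A].

Definition optimal_ferrers_code D (k delta : nat)
    (C : {vspace 'M[K]_(m, n)}) : Prop :=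
  ferrers_code D k delta C /\ k = min_dots_outside D delta.

End Codes.
End Diagrams.

(* Main.v *)
(* Put w = n - y, e = y - delta, d = delta - 1, s = y - 1 = e + d, q = #|K|, and
   let L, M be the extensions of K of degree s and w.  A codeword is built from
   a in L, a q-polynomial G over L with e coefficients, and mu in M.  With a
   basis (b_j) of L, a q-polynomial A of q-degree 1 whose kernel is K b_0, and
   F = a X + G o A, the word has
   - mu times the first d basis vectors of M in the top left d x w block;
   - F(b_0), ..., F(b_(s-1)) in the next s columns;
   - in the last column, G(bt) in rows < s, where bt is not a value of A,
     and below it the tail F(b_0) - (0^d, mu).
   If the tail is nonzero, it adds 1 to the rank of the rest, which is at least
   d either by mu <> 0 or because F has q-degree at most e.  If the tail
   vanishes, F(b_0) = (0^d, mu): for mu <> 0 some nonzero entry of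
   column w in a row >= d adds 1 to the rank d of the top left block; for mu = 0
   we get a = 0, and the last s columns hold the values of G, of q-degree < e,
   on the basis A(b_1), ..., A(b_(s-1)), bt, so their rank exceeds s - e = d.
   Cells outside the diagram and the part of the tail that does not fit into
   the m rows are killed by linear conditions, whose number leaves the
   dimension that is claimed. *)

Require Import Defs.
From HB Require Import structures.
From mathcomp Require Import all_boot all_order all_algebra.
From mathcomp Require Import all_fingroup all_field.
From mathcomp Require Import zify ring.

Set Implicit Arguments.
Unset Strict Implicit.
Unset Printing Implicit Defensive.

Import GRing.Theory.

Local Open Scope ring_scope.

(** * Finite extensions of finite fields *)

Section FieldExtension.

Variable K : finFieldType.
Local Notation q := #|K|.

Lemma expf_card_exp (a : K) i : a ^+ (q ^ i)%N = a.
Proof.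
by elim: i => [|i IHi]; rewrite ?expr1 // expnSr exprM IHi expf_card.
Qed.

Lemma pchar_nat_card_exp (L : fieldExtType K) i : [pchar L].-nat (q ^ i)%N.
Proof.
have [p p_pr pcharK] := finPcharP K.
rewrite pnatX (card_pprimeChar pcharK) pnatX; apply/orP; left; apply/orP; left.
rewrite (@eq_pnat _ p); first exact: pnat_id.
by apply: pcharf_eq; rewrite pchar_lalg.
Qed.

Lemma frobenius_linear (L : fieldExtType K) i :
  linear (fun x : L => x ^+ (q ^ i)%N).
Proof.
move=> a x y; rewrite exprDn_pchar ?pchar_nat_card_exp //.
by rewrite exprZn expf_card_exp.
Qed.

(* The roots of [X^(q^s) - X] in a splitting field are the points fixed by a
   power of Frobenius, hence a subfield, which must then be everything. *)
Lemma fieldExt_of_dim s :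
  (0 < s)%N -> exists L : fieldExtType K, \dim {:L} = s.
Proof.
move=> s_gt0; pose N := (q ^ s)%N.
have N_gt1 : (1 < N)%N by rewrite -(exp1n s) ltn_exp2r // finNzRing_gt1.
pose p (R : nzRingType) : {poly R} := 'X^N - 'X.
have size_p (R : nzRingType) : size (p R) = N.+1.
  by rewrite /p size_polyDl size_polyXn // size_polyN size_polyX ltnS.
have p_neq0 : p K != 0 by rewrite -size_poly_gt0 size_p.
have [L] := FinSplittingFieldFor p_neq0.
rewrite [map_poly _ _]rmorphB rmorphXn /= map_polyX => -[zs Dzs gen_zs].
rewrite -/(p L) in Dzs.
(* Hence ['X^N - 'X] has derivative [-1]: it is separable, with [N] distinct roots. *)
have N0 : N%:R = 0 :> L.
  have [r r_pr pcharK] := finPcharP K.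
  rewrite /N (card_pprimeChar pcharK) -expnM natrX.
  have pcharL : r \in [pchar L] by rewrite pchar_lalg.
  rewrite (pcharf0 pcharL) expr0n; case: eqP => // /eqP.
  rewrite muln_eq0 (gtn_eqF s_gt0) orbF => /eqP d0.
  by have := finNzRing_gt1 K; rewrite (card_pprimeChar pcharK) d0.
have uniq_zs : uniq zs.
  rewrite -separable_prod_XsubC -(eqp_separable Dzs) unlock.
  rewrite derivB derivXn derivX -mulr_natr -polyC_natr N0 polyC0 mulr0 sub0r.
  rewrite coprimep_sym -[-1]scaleN1r.
  by rewrite coprimepZl ?oppr_eq0 ?oner_eq0 ?coprime1p.
have size_zs : size zs = N.
  by apply: succn_inj; rewrite -(size_prod_XsubC zs id) -(eqp_size Dzs) size_p.
have zs_root z : z \in zs -> z ^+ N = z.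
  rewrite -root_prod_XsubC -(eqp_root Dzs) rootE !hornerE.
  by rewrite subr_eq0 => /eqP.
have [a _ Da] := finField_galois_generator (sub1v {:L}%AS).
rewrite /= dimv1 expn1 in Da.
have Das i x : (a ^+ i)%g x = x ^+ (q ^ i)%N.
  elim: i => [|i IHi]; first by rewrite gal_id expn0.
  by rewrite expgSr galM ?Da ?memvf // IHi -exprM -expnSr.
pose E := fixedSpace (a ^+ s)%g.
have zsE z : z \in zs -> z \in E.
  by move=> z_zs; apply/fixedSpaceP; rewrite Das; apply: zs_root.
have E_full : E = {:L}%VS.
  apply/eqP; rewrite eqEsubv subvf -gen_zs -[E]subfield_closed agenvS //.
  by rewrite subv_add sub1v; apply/span_subvP.
have L_root (x : L) : x ^+ N = x.
  by have /fixedSpaceP : x \in E by [rewrite E_full memvf]; rewrite Das.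
pose Fm := finvect_type L.
have cardL : #|Fm| = (q ^ \dim {:L})%N.
  by rewrite -(card_vspacef (Vector.class Fm)) card_vspace.
exists L; apply/eqP; rewrite -(@eqn_exp2l q) ?finNzRing_gt1 // -cardL -/N.
rewrite -size_zs -(@card_uniqP Fm zs uniq_zs); apply/eqP/eq_card => x.
rewrite [LHS]inE.
rewrite -[RHS]root_prod_XsubC -(eqp_root Dzs) rootE !hornerE.
by rewrite L_root subrr eqxx.
Qed.

End FieldExtension.

(** * Coordinates and ranks *)

Section NatCoordinates.

Variables (K : fieldType) (V : vectType K).
Implicit Types (i : nat) (u : V).

(* Indexed by [nat], with junk value 0 from [\dim {:V}] on. *)
Definition coordn i u : K :=
  oapp (fun k => coord (vbasis {:V}) k u) 0 (insub i : option 'I_(\dim {:V})).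

Lemma coordn_is_scalar i : scalar (coordn i).
Proof.
move=> a u v; rewrite /coordn.
by case: insub => [k|] /=; rewrite ?linearP ?mulr0 ?addr0.
Qed.
HB.instance Definition _ i :=
  GRing.isLinear.Build K V K *%R (coordn i) (coordn_is_scalar i).

Lemma coordn_out i u : (\dim {:V} <= i)%N -> coordn i u = 0.
Proof. by rewrite /coordn leqNgt => /negP; case: insubP => [k -> //|]. Qed.

Lemma coordn_inj u : (forall i, (i < \dim {:V})%N -> coordn i u = 0) -> u = 0.
Proof.
move=> u0; rewrite (coord_vbasis (memvf u)) big1 // => i _.
by have := u0 i (ltn_ord i); rewrite /coordn valK /= => ->; rewrite scale0r.
Qed.

Lemma vbasis_indep p (v : 'I_p -> K) :
    (p <= \dim {:V})%N -> \sum_(j < p) v j *: (vbasis {:V})`_j = 0 ->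
  forall j, v j = 0.
Proof.
move=> le_p v0 j; pose v' i := oapp v 0 (insub i : option 'I_p).
have v'E k : v' (val k) = v k by rewrite /v' valK.
have /freeP/(_ (v' \o val)) := basis_free (vbasisP {:V}).
move=> /(_ _ (widen_ord le_p j)) /=; rewrite v'E; apply.
rewrite -[RHS]v0 -(eq_bigr _ (fun k _ => congr1 (fun c => c *: _) (v'E k))).
rewrite (big_ord_widen _ (fun k => v' k *: (vbasis {:V})`_k) le_p).
rewrite [RHS]big_mkcond /=; apply: eq_bigr => k _; case: ifPn => // k_ge.
by rewrite /v' insubN // scale0r.
Qed.

Lemma vbasis0_neq0 : (0 < \dim {:V})%N -> (vbasis {:V})`_0 != 0.
Proof.
move=> dimV; apply/eqP=> b0; have := @vbasis_indep 1 (fun=> 1) dimV.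
by rewrite big_ord1 b0 scaler0 => /(_ erefl ord0)/eqP; rewrite oner_eq0.
Qed.

End NatCoordinates.

Section MatrixRank.

Variable K : fieldType.

Lemma colsub_mul1 m n n' (g : 'I_n' -> 'I_n) (A : 'M[K]_(m, n)) :
  colsub g A = A *m colsub g 1%:M.
Proof. by rewrite mulmx_colsub mulmx1. Qed.

Lemma mxrank_mxsub m n m' n' (f : 'I_m' -> 'I_m) (g : 'I_n' -> 'I_n)
  (A : 'M[K]_(m, n)) : (\rank (mxsub f g A) <= \rank A)%N.
Proof.
have -> : mxsub f g A = rowsub f (colsub g A).
  by apply/matrixP=> i j; rewrite !mxE.
apply: leq_trans (mxrankS (rowsub_sub _ _)) _.
by rewrite colsub_mul1 mxrankM_maxl.
Qed.

(* A row that vanishes on the selected columns but not elsewhere is not in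
   the span of what the column selection sees. *)
Lemma mxrank_colsub_lt m n n' (g : 'I_n' -> 'I_n) (A : 'M[K]_(m, n)) i j :
  (forall k, A i (g k) = 0) -> A i j != 0 ->
  (\rank (colsub g A) < \rank A)%N.
Proof.
move=> Ai0 Aij; rewrite -(mxrank_mul_ker A (colsub g 1%:M)) -colsub_mul1.
rewrite -addn1 leq_add2l lt0n mxrank_eq0; apply/eqP=> cap0.
have: (row i A <= A :&: kermx (colsub g 1%:M))%MS.
  rewrite sub_capmx row_sub; apply/sub_kermxP; rewrite -row_mul -colsub_mul1.
  by apply/rowP=> k; rewrite !mxE Ai0.
rewrite cap0 submx0 => /eqP/rowP/(_ j)/eqP.
by rewrite !mxE (negPf Aij).
Qed.

End MatrixRank.

Section Linearized.

Variables (K : finFieldType) (L : fieldExtType K).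
Local Notation q := #|K|.

(* The kernel of a q-polynomial has at most as many elements as its degree. *)
Lemma mxrank_linearized m p d (gam : 'I_p -> L) (phi : 'I_m -> L -> K)
    (F : {poly L}) (A : 'M[K]_(m, p)) :
    F != 0 -> (size F <= (q ^ d).+1)%N -> linear (horner F) ->
    (forall i, scalar (phi i)) ->
    (forall u, (forall i, phi i u = 0) -> u = 0) ->
    (forall v : 'I_p -> K, \sum_j v j *: gam j = 0 -> forall j, v j = 0) ->
    (forall i j, A i j = phi i F.[gam j]) ->
  (p <= \rank A + d)%N.
Proof.
move=> F0 sizeF linF lin_phi phi0 gam_free DA.
(* A relation between the columns of [A], applied to the [gam j], gives a root of [F]; distinct
   relations give distinct roots. *)
pose W := row_base (kermx A^T).
have W_free : row_free W by apply: row_base_free.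
pose h (w : 'rV_(\rank (kermx A^T))) : L := \sum_j (w *m W) 0 j *: gam j.
pose FL : {linear L -> L} :=
  HB.pack (horner F) (GRing.isLinear.Build _ _ _ _ _ linF).
have h_root w : root F (h w).
  apply/eqP/phi0 => i.
  pose ph : {linear L -> K | *%R} :=
    HB.pack (phi i) (GRing.isLinear.Build _ _ _ _ _ (lin_phi i)).
  rewrite -[F.[_]]/(FL _) -[phi i _]/(ph _) /h !linear_sum.
  transitivity ((w *m W *m A^T) 0 i).
    rewrite mxE; apply: eq_bigr => j _; rewrite !linearZ.
    by rewrite [(A^T) j i]mxE DA.
  have /sub_kermxP-> : (w *m W <= kermx A^T)%MS.
    by rewrite mulmx_sub // eq_row_base.
  by rewrite mxE.
have h_inj : injective h.
  move=> w1 w2 /eqP; rewrite -subr_eq0 /h -sumrB => /eqP h0.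
  apply: (row_free_inj W_free); apply/rowP=> j; apply/eqP; rewrite -subr_eq0.
  apply/eqP; apply: (gam_free (fun j => (w1 *m W) 0 j - (w2 *m W) 0 j)).
  by rewrite -[RHS]h0; apply: eq_bigr => k _; rewrite scalerBl.
have := @max_poly_roots _ F (map h (enum predT)) F0.
rewrite map_inj_uniq // enum_uniq size_map -cardE card_mx mul1n => roots_lt.
have: (q ^ \rank (kermx A^T) < size F)%N.
  by apply: roots_lt => //; apply/allP=> _ /mapP[w _ ->]; apply: h_root.
move/leq_trans/(_ sizeF); rewrite ltnS leq_exp2l ?finNzRing_gt1 //.
by rewrite mxrank_ker mxrank_tr leq_subLR.
Qed.

End Linearized.

(** * Subspaces cut out by linear conditions *)

Section VspaceCount.

Variables (K : fieldType) (X : vectType K).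

(** Each condition costs at most one dimension, whether or not the conditions are independent. *)
Lemma common_zeros_dim (I : Type) (phi : I -> X -> K) (ts : seq I) :
    (forall t, scalar (phi t)) ->
  exists2 U : {vspace X}, (\dim {:X} <= \dim U + size ts)%N
    & forall x, x \in U -> all (fun t => phi t x == 0) ts.
Proof.
move=> lin_phi; elim: ts => [|t ts [U dimU U0]].
  by exists fullv; rewrite ?addn0.
pose ph : {linear X -> K^o} :=
  HB.pack (phi t) (GRing.isLinear.Build K X K^o _ (phi t) (lin_phi t)).
exists (U :&: lker (linfun ph))%VS => [|x]; last first.
  rewrite memv_cap memv_ker lfunE => /andP[/U0 U0x /= pht].
  by apply/andP; split.
apply: leq_trans dimU _; rewrite -(limg_ker_dim (linfun ph) U) -addnA leq_add2l.
rewrite /= -add1n leq_add2r.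
by apply: leq_trans (dimvS (subvf _)) _; rewrite dimvf.
Qed.

(** Cuts a solution space, whose dimension is only bounded below, down to the exact dimension of a
    code. *)
Lemma subspace_of_dim (U : {vspace X}) k :
  (k <= \dim U)%N -> exists2 W : {vspace X}, (W <= U)%VS & \dim W = k.
Proof.
move=> le_k; exists <<take k (vbasis U)>>%VS.
  by apply/span_subvP=> x /mem_take; apply: vbasis_mem.
have: free (take k (vbasis U)).
  apply: (@catl_free _ _ (drop k (vbasis U))).
  by rewrite cat_take_drop (basis_free (vbasisP U)).
by rewrite /free => /eqP->; rewrite size_takel // size_tuple.
Qed.

End VspaceCount.

(** * q-polynomials *)

Section QPolynomials.

Variables (K : finFieldType) (L : fieldExtType K).
Local Notation q := #|K|.
Local Notation b := (vbasis {:L}).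

Lemma q_gt0 : (0 < q)%N. Proof. exact: ltnW (finNzRing_gt1 K). Qed.

Definition linpoly e (g : {ffun 'I_e -> L}) : {poly L} :=
  \sum_(i < e) g i *: 'X^(q ^ i).

Lemma horner_linpoly e (g : {ffun 'I_e -> L}) x :
  (linpoly g).[x] = \sum_(i < e) g i * x ^+ (q ^ i)%N.
Proof. by rewrite horner_sum; apply: eq_bigr => i _; rewrite !hornerE. Qed.

Lemma horner_linpoly_linear e (g : {ffun 'I_e -> L}) :
  linear (horner (linpoly g)).
Proof.
move=> c x y; rewrite !horner_linpoly scaler_sumr -big_split /=.
by apply: eq_bigr => i _; rewrite frobenius_linear mulrDr scalerAr.
Qed.

Lemma linpolyP e c (g h : {ffun 'I_e -> L}) x :
  (linpoly (c *: g + h)).[x] = c *: (linpoly g).[x] + (linpoly h).[x].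
Proof.
rewrite !horner_linpoly scaler_sumr -big_split /=.
by apply: eq_bigr => i _; rewrite !ffunE mulrDl scalerAl.
Qed.

Lemma size_linpoly e (g : {ffun 'I_e.+1 -> L}) :
  (size (linpoly g) <= (q ^ e).+1)%N.
Proof.
apply: leq_trans (size_sum _ _ _) _; apply/bigmax_leqP=> i _.
apply: leq_trans (size_scale_leq _ _) _.
by rewrite size_polyXn ltnS leq_exp2l ?finNzRing_gt1 // -ltnS.
Qed.

Lemma linpoly_eq0 e (g : {ffun 'I_e -> L}) : linpoly g = 0 -> g = 0.
Proof.
move=> g0; apply/ffunP=> i; rewrite ffunE.
have := congr1 (fun p : {poly L} => p`_(q ^ i)%N) g0; rewrite coef0 => <-.
rewrite coef_sum (bigD1 i) //= coefZ coefXn eqxx mulr1 big1 ?addr0 // => j ji.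
rewrite coefZ coefXn eqn_exp2l ?finNzRing_gt1 //.
by case: eqP => [/val_inj ij|_]; [rewrite ij eqxx in ji | rewrite mulr0].
Qed.

(* The q-polynomial whose zeros are the [K]-multiples of [b`_0]. *)
Definition annih : {poly L} := 'X^q - b`_0 ^+ q.-1 *: 'X.

Lemma horner_annih x : annih.[x] = x ^+ q - b`_0 ^+ q.-1 * x.
Proof. by rewrite !hornerE. Qed.

Lemma horner_annih_linear : linear (horner annih).
Proof.
move=> c x y; rewrite !horner_annih.
have := frobenius_linear 1 c x y; rewrite expn1 => ->.
by rewrite mulrDr -scalerAr scalerBr; ring.
Qed.

Lemma size_annih : size annih = q.+1.
Proof.
rewrite size_polyDl size_polyXn // size_polyN ltnS.
by apply: leq_trans (size_scale_leq _ _) _; rewrite size_polyX finNzRing_gt1.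
Qed.

Lemma horner_annih0 : annih.[b`_0] = 0.
Proof. by rewrite horner_annih -exprSr prednK ?q_gt0 // subrr. Qed.

(** The quotient of a root by b_0 is fixed by the Frobenius map, hence lies in [K]. *)
Lemma annih_root x : b`_0 != 0 -> annih.[x] = 0 -> exists c : K, x = c *: b`_0.
Proof.
move=> b0; rewrite horner_annih => /eqP; rewrite subr_eq0 => /eqP xq.
have: x / b`_0 \in 1%VS.
  rewrite (Fermat's_little_theorem 1%AS) /= dimv1 expn1 expr_div_n xq.
  rewrite -{2}(prednK q_gt0) exprS; apply/eqP.
  by rewrite invfM mulrA [_ * x]mulrC mulrAC mulfK ?expf_neq0.
by case/vlineP=> c /(canRL (mulfVK b0)); rewrite mulr_algl; exists c.
Qed.

Definition outer_poly e (a : L) (g : {ffun 'I_e -> L}) : {poly L} :=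
  a *: 'X + (linpoly g \Po annih).

Lemma horner_outer e a (g : {ffun 'I_e -> L}) x :
  (outer_poly a g).[x] = a * x + (linpoly g).[annih.[x]].
Proof. by rewrite hornerD hornerZ hornerX horner_comp. Qed.

Lemma horner_outer0 e a (g : {ffun 'I_e -> L}) :
  (outer_poly a g).[b`_0] = a * b`_0.
Proof.
rewrite horner_outer horner_annih0 horner_linpoly big1 ?addr0 // => i _.
by rewrite expr0n expn_eq0 (gtn_eqF q_gt0) mulr0.
Qed.

Lemma horner_outer_linear e a (g : {ffun 'I_e -> L}) :
  linear (horner (outer_poly a g)).
Proof.
move=> c x y; rewrite !horner_outer horner_annih_linear horner_linpoly_linear.
by rewrite mulrDr -scalerAr scalerDr !addrA; congr (_ + _); rewrite addrAC.
Qed.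

Lemma outerP e c a a' (g g' : {ffun 'I_e -> L}) x :
  (outer_poly (c *: a + a') (c *: g + g')).[x] =
    c *: (outer_poly a g).[x] + (outer_poly a' g').[x].
Proof.
rewrite !horner_outer linpolyP mulrDl -scalerAl scalerDr !addrA.
by congr (_ + _); rewrite addrAC.
Qed.

Lemma size_outer e a (g : {ffun 'I_e -> L}) :
  (size (outer_poly a g) <= (q ^ e).+1)%N.
Proof.
apply: leq_trans (size_polyD _ _) _; rewrite geq_max; apply/andP; split.
  apply: leq_trans (size_scale_leq _ _) _.
  by rewrite size_polyX ltnS expn_gt0 q_gt0.
apply: leq_trans (size_comp_poly_leq _ _) _; rewrite size_annih /= ltnS.
case: e g => [|e] g; first by rewrite /linpoly big_ord0 size_poly0.
rewrite expnSr leq_pmul2r ?q_gt0 // -subn1 leq_subLR add1n.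
exact: size_linpoly.
Qed.

(** At b_0 the composite with [annih] vanishes, which isolates [a]; composing with the nonconstant
    [annih] is injective, which settles [g]. *)
Lemma outer_eq0 e a (g : {ffun 'I_e -> L}) :
  b`_0 != 0 -> outer_poly a g = 0 -> a = 0 /\ g = 0.
Proof.
move=> b0 ag0; have a0 : a = 0.
  apply/eqP; rewrite -(mulIr_eq0 _ (mulIf b0)) -(horner_outer0 a g).
  by rewrite ag0 horner0.
split=> //; apply: linpoly_eq0; apply/eqP.
by rewrite -(@comp_poly_eq0 _ _ annih) ?size_annih ?ltnS ?q_gt0 //
  -ag0 /outer_poly a0 scale0r add0r.
Qed.

(* The values of [annih] span a hyperplane; any point outside it completes the
   images of the remaining basis vectors to a basis. *)
Lemma annih_basis s : \dim {:L} = s.+1 -> b`_0 != 0 ->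
  exists bt : L, forall v : 'I_s.+1 -> K,
    \sum_j v j *: (if (j < s)%N then annih.[b`_j.+1] else bt) = 0 ->
    forall j, v j = 0.
Proof.
move=> dimL b0.
pose sg : {linear L -> L} :=
  HB.pack (horner annih) (GRing.isLinear.Build _ _ _ _ _ horner_annih_linear).
have [bt bt_notin] : exists bt, bt \notin limg (linfun sg).
  have ker_gt0 : (0 < \dim (lker (linfun sg)))%N.
    rewrite lt0n dimv_eq0; apply: contraNneq b0 => ker0.
    by rewrite -memv0 -ker0 memv_ker lfunE /= horner_annih0.
  have := limg_ker_dim (linfun sg) fullv; rewrite capfv => dimE.
  have: ~~ (fullv <= limg (linfun sg))%VS.
    by apply/negP=> /dimvS; rewrite -dimE; lia.
  by case/subvPn=> bt _; exists bt.
exists bt => v; rewrite big_ord_recr /= ltnn => v0.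
have {}v0 : annih.[\sum_(j < s) v (widen_ord (leqnSn s) j) *: b`_j.+1]
    + v ord_max *: bt = 0.
  rewrite -[RHS]v0; congr (_ + _); rewrite -[LHS]/(sg _) linear_sum.
  by apply: eq_bigr => j _; rewrite linearZ /= ltn_ord.
have vmax : v ord_max = 0.
  apply: contraNeq bt_notin => vmax; rewrite -[bt](scalerK vmax) memvZ //.
  move/eqP: v0; rewrite addrC addr_eq0 => /eqP->; rewrite memvN.
  by apply/memv_imgP; eexists; rewrite ?memvf // lfunE.
move: v0; rewrite vmax scale0r addr0 => /(annih_root b0)[c Dc].
(* A combination of the b_(j+1) equals c b_0; [u] turns this into a relation on the whole basis,
   with [- c] at b_0. *)
pose u (j : 'I_s.+1) :=
  oapp (fun k => v (widen_ord (leqnSn s) k)) (- c) (unlift ord0 j).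
have u0 : forall j, u j = 0.
  apply: (vbasis_indep (V := L)); first by rewrite dimL.
  rewrite big_ord_recl /= /u unlift_none /= scaleNr -Dc addrC.
  by apply/eqP; rewrite subr_eq0; apply/eqP/eq_bigr => j _; rewrite liftK.
move=> j; case: (unliftP ord_max j) => [k ->|-> //].
have := u0 (lift ord0 k); rewrite /u liftK /= => <-; congr v.
by apply: val_inj; rewrite /= /bump leqNgt ltn_ord.
Qed.

End QPolynomials.

(** * The code *)

Section Codeword.

Variables (K : finFieldType) (L M : fieldExtType K) (e d w : nat) (bt : L).
Local Notation s := (e + d)%N.
Local Notation X := (L * {ffun 'I_e -> L} * M)%type.
Implicit Type x : X.

Definition inner_val x (j : nat) : L :=
  (outer_poly x.1.1 x.1.2).[(vbasis {:L})`_j].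

(** The height of the matrix does not bound [l]: entries that would fall below the last row are made
    to vanish by separate conditions. *)
Definition tail_entry l x : K :=
  coordn l (inner_val x 0) - (if (l < d)%N then 0 else coordn (l - d) x.2).

Definition entry i j x : K :=
  if (j < w)%N then
    if (i < d)%N then coordn j (x.2 * (vbasis {:M})`_i) else 0
  else if (j < w + s)%N then coordn i (inner_val x (j - w))
  else if (i < s)%N then coordn i (linpoly x.1.2).[bt]
  else tail_entry (i - s) x.

Definition codeword m x : 'M[K]_(m, (w + s).+1) := \matrix_(i, j) entry i j x.

Lemma inner_val_linear j c x y :
  inner_val (c *: x + y) j = c *: inner_val x j + inner_val y j.
Proof. exact: outerP. Qed.

Lemma tail_entry_scalar l : scalar (tail_entry l).
Proof.
move=> c x y; rewrite /tail_entry inner_val_linear linearP /=.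
by case: ifP => _; rewrite ?linearP /=; ring.
Qed.

Lemma entry_scalar i j : scalar (entry i j).
Proof.
move=> c x y; rewrite /entry; case: ifP => _.
  by case: ifP => _; rewrite ?mulr0 ?addr0 // mulrDl -scalerAl linearP.
case: ifP => _; first by rewrite inner_val_linear linearP.
by case: ifP => _; [rewrite linpolyP linearP | rewrite tail_entry_scalar].
Qed.

Lemma codeword_linear m : linear (@codeword m).
Proof.
by move=> c x y; apply/matrixP=> i j; rewrite !mxE entry_scalar.
Qed.

Hypotheses (dimL : \dim {:L} = s) (dimM : \dim {:M} = w).
Hypotheses (d_gt0 : (0 < d)%N) (le_dw : (d <= w)%N).
Hypothesis bt_basis : forall v : 'I_s -> K,
  \sum_j v j *: (if (j < s.-1)%N then (annih L).[(vbasis {:L})`_j.+1]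
                 else bt) = 0 ->
  forall j, v j = 0.

Variable m : nat.
Hypothesis le_sm : (s <= m)%N.
Local Notation E x := (codeword m x).
Local Notation lcols :=
  (fun j => widen_ord (leqnSn _) (widen_ord (leq_addr s w) j)).
Local Notation icols := (widen_ord (leqnSn (w + s)%N)).

Lemma coordnL_inj (u : L) : (forall i : 'I_s, coordn i u = 0) -> u = 0.
Proof.
move=> u0; apply: coordn_inj => i; rewrite dimL => lt_i.
exact: (u0 (Ordinal lt_i)).
Qed.

(** Multiplication by [x.2] is a q-polynomial of q-degree 0, so the transposed top left block has
    rank [d]. *)
Lemma rank_left x : x.2 != 0 -> (d <= \rank (colsub lcols (E x)))%N.
Proof.
move=> mu0; have le_dm : (d <= m)%N by apply: leq_trans le_sm; apply: leq_addl.
pose B := rowsub (widen_ord le_dm) (colsub lcols (E x)).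
apply: leq_trans (_ : \rank B^T + 0 <= _)%N.
  apply: (@mxrank_linearized K M w d 0 (fun i => (vbasis {:M})`_i)
    (fun i => coordn i) (x.2 *: 'X)).
  - by rewrite scaler_eq0 negb_or mu0 polyX_eq0.
  - by rewrite (leq_trans (size_scale_leq _ _)) // size_polyX expn0.
  - by move=> c u v; rewrite !hornerE mulrDr -scalerAr.
  - by move=> i; apply: coordn_is_scalar.
  - move=> u u0; apply: coordn_inj => i; rewrite dimM => lt_i.
    exact: (u0 (Ordinal lt_i)).
  - by move=> v; apply: vbasis_indep; rewrite dimM.
  - by move=> i j; rewrite !mxE /entry /= !ltn_ord !hornerE.
by rewrite addn0 mxrank_tr mxrankS // rowsub_sub.
Qed.

Lemma rank_inner x : x.2 = 0 -> x != 0 -> (d <= \rank (colsub icols (E x)))%N.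
Proof.
move=> mu0 x0; have s_gt0 : (0 < s)%N by rewrite addn_gt0 d_gt0 orbT.
pose f : 'I_s -> 'I_m := widen_ord le_sm.
have rankE := mxrank_mxsub f (@rshift w s) (colsub icols (E x)).
apply: leq_trans rankE; rewrite -(leq_add2r e) [(d + e)%N]addnC.
apply: (@mxrank_linearized K L s s e (fun j => (vbasis {:L})`_j)
    (fun i => coordn i) (outer_poly x.1.1 x.1.2)).
- apply: contraNneq x0 => /outer_eq0[|a0 g0].
    by rewrite vbasis0_neq0 ?dimL.
  by apply/eqP; case: x mu0 a0 g0 => [[a g] mu] /= -> -> ->.
- exact: size_outer.
- exact: horner_outer_linear.
- by move=> i; apply: coordn_is_scalar.
- exact: coordnL_inj.
- by move=> v; apply: vbasis_indep; rewrite dimL.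
- move=> i j; rewrite !mxE /entry /= ltnNge leq_addr /= ltn_add2l ltn_ord.
  by rewrite addKn.
Qed.

(** Trading column [w], the value at b_0, for the last column gives the values of [linpoly x.1.2] on
    another basis. Its q-degree is below [e], which gains one over [rank_inner]. *)
Lemma rank_shifted x : x.1.1 = 0 -> x.1.2 != 0 -> (d < \rank (E x))%N.
Proof.
move=> a0 g0; have s_gt0 : (0 < s)%N by rewrite addn_gt0 d_gt0 orbT.
have cardE j : (j < s -> w + j.+1 < (w + s).+1)%N by lia.
pose f : 'I_s -> 'I_m := widen_ord le_sm.
pose h (j : 'I_s) : 'I_(w + s).+1 := Ordinal (cardE j (ltn_ord j)).
apply: leq_trans (mxrank_mxsub f h (E x)).
have [e' De] : exists e', e = e'.+1.
  by case: (e) x.1.2 g0 => [|e'] g; [case/eqP; apply/ffunP; case | exists e'].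
rewrite -(leq_add2r e') -[X in (X <= _)%N](_ : s = _); last by rewrite De; lia.
apply: (mxrank_linearized (gam := fun j : 'I_s => if (j < s.-1)%N
    then (annih L).[(vbasis {:L})`_j.+1] else bt)
    (phi := fun i => coordn i) (F := linpoly x.1.2)).
- by apply: contraNneq g0 => /linpoly_eq0->.
- by move: (x.1.2); rewrite De; apply: size_linpoly.
- exact: horner_linpoly_linear.
- by move=> i; apply: coordn_is_scalar.
- exact: coordnL_inj.
- exact: bt_basis.
- move=> i j; rewrite !mxE /entry /= ltnNge leq_addr /= ltn_add2l ltn_ord.
  rewrite [(j.+1 < s)%N](_ : _ = (j < s.-1)%N); last by lia.
  rewrite addKn /inner_val horner_outer a0 mul0r add0r.
  by case: ifP.
Qed.

Lemma rank_codeword x :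
    (forall l, (m - s <= l)%N -> tail_entry l x = 0) -> x != 0 ->
  (d < \rank (E x))%N.
Proof.
move=> tail0 x0; have s_gt0 : (0 < s)%N by rewrite addn_gt0 d_gt0 orbT.
have lcols_icols : colsub lcols (E x) =
    colsub (widen_ord (leq_addr s w)) (colsub icols (E x)).
  by apply/matrixP=> i j; rewrite !mxE.
have [/existsP[l cl0]|] := boolP [exists l : 'I_(m - s), tail_entry l x != 0].
  have lt_l : (s + l < m)%N by have := ltn_ord l; lia.
  (* Row [s + l] is zero outside the last column: it lies below the top left block and past all
     coordinates of [L]. *)
  apply: (@leq_ltn_trans (\rank (colsub icols (E x)))); last first.
    apply: (@mxrank_colsub_lt _ _ _ _ _ _ (Ordinal lt_l) ord_max) => [k|].
      rewrite mxE /entry /= ltn_ord; case: ifP => _.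
        by rewrite ltnNge -addnA addnC -addnA leq_addr.
      by rewrite coordn_out // dimL leq_addr.
    by rewrite mxE /entry /= ltnNge leq_addr /= ltnn ltnNge leq_addr /= addKn.
  have [mu0|mu0] := eqVneq x.2 0; first exact: rank_inner.
  by apply: leq_trans (rank_left mu0) _; rewrite lcols_icols mxrank_mxsub.
rewrite negb_exists => /forallP tail0'.
have {tail0 tail0'} tail0 l : tail_entry l x = 0.
  have [/tail0 //|lt_l] := leqP (m - s)%N l.
  by have /negPn/eqP := tail0' (Ordinal lt_l).
have [mu0|mu0] := eqVneq x.2 0.
  have v0 : inner_val x 0 = 0.
    apply: coordn_inj => l _; have := tail0 l.
    by rewrite /tail_entry mu0 linear0 if_same subr0.
  have b0 : (vbasis {:L})`_0 != 0 by rewrite vbasis0_neq0 ?dimL.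
  have a0 : x.1.1 = 0.
    apply/eqP; rewrite -(mulIr_eq0 _ (mulIf b0)) -(horner_outer0 _ x.1.2).
    exact/eqP.
  apply: rank_shifted => //; apply: contraNneq x0 => g0.
  apply/eqP; case: x mu0 a0 g0 {tail0 v0 lcols_icols} => [[a g] mu] /=.
  by move=> -> -> ->.
have [l mul0] : exists l, coordn l x.2 != 0.
  have: ~~ [forall l : 'I_w, coordn l x.2 == 0].
    apply: contra mu0 => /forallP mu0; apply/eqP/coordn_inj => l.
    rewrite dimM => lt_l.
    exact/eqP/(mu0 (Ordinal lt_l)).
  by rewrite negb_forall => /existsP[l ?]; exists l.
(* As the tail vanishes, coordinate [d + l] of the value at b_0 is coordinate [l] of [x.2]. Row
   [d + l] misses the top left block but is nonzero in column [w]. *)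
have v0 : coordn (d + l) (inner_val x 0) != 0.
  have := tail0 (d + l)%N; rewrite /tail_entry ltnNge leq_addr /= addKn.
  by move=> /eqP; rewrite subr_eq0 => /eqP->.
have lt_ls : (d + l < s)%N.
  by rewrite ltnNge -dimL; apply: contra v0 => /coordn_out->.
apply: leq_ltn_trans (rank_left mu0) _.
have lt_w : (w < (w + s).+1)%N by lia.
have lt_m := leq_trans lt_ls le_sm.
apply: (@mxrank_colsub_lt _ _ _ _ _ _ (Ordinal lt_m) (Ordinal lt_w)) => [k|].
  by rewrite mxE /entry /= ltn_ord ltnNge leq_addr.
by rewrite mxE /entry /= ltnn -[X in (X < _)%N]addn0 ltn_add2l s_gt0 subnn.
Qed.

End Codeword.

Local Close Scope ring_scope.

(** * Counting dots *)

Section Counting.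

Lemma sum_ord_window m c t : c <= m -> \sum_(i < m) (t <= i < c) = c - t.
Proof.
suff sumE : \sum_(i < m) (t <= i < c) = minn m c - t.
  by move=> /minn_idPr c_m; rewrite sumE c_m.
by elim: m => [|m IHm]; rewrite ?big_ord0 ?big_ord_recr /= ?IHm; lia.
Qed.

(** Such a set either contains the first [i + 1] indices or lies within the first [i]; its
    cardinality tells which. *)
Lemma mem_initial_segment m (A : {set 'I_m}) :
    (forall i i' : 'I_m, i' <= i -> i \in A -> i' \in A) ->
  forall i, (i \in A) = (i < #|A|).
Proof.
move=> closedA i; have card_lt c : c <= m -> #|[set k : 'I_m | k < c]| = c.
  move=> le_cm; rewrite -sum1dep_card big_mkcond /= -[RHS]subn0.
  by rewrite -(sum_ord_window 0 le_cm); apply: eq_bigr => k _; case: ifP.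
apply/idP/idP=> [Ai|]; last apply: contraTT => Ai.
  rewrite -[X in X <= _](card_lt _ (ltn_ord i)) subset_leq_card //.
  by apply/subsetP=> k; rewrite inE ltnS => /closedA; apply.
rewrite -leqNgt -[X in _ <= X](card_lt _ (ltnW (ltn_ord i))) subset_leq_card //.
apply/subsetP=> k Ak; rewrite inE ltnNge; apply: contra Ai => /closedA.
exact.
Qed.

(** The default [x0] takes part in the minimum, hence its own lower bound. *)
Lemma bigminn_eq (I : finType) x0 (F : I -> nat) k i0 :
    k <= x0 -> (forall i, k <= F i) -> F i0 = k ->
  \big[minn/x0]_i F i = k.
Proof.
move=> k_x0 k_F Fi0; apply/eqP; rewrite eqn_leq andbC; apply/andP; split.
  by apply: (big_ind (leq k)) => // x y kx ky; rewrite leq_min kx ky.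
rewrite -Fi0; have := mem_index_enum i0; elim: (index_enum I) => //= i r IHr.
rewrite inE big_cons geq_min => /predU1P[->|/IHr ->]; first by rewrite leqnn.
by rewrite orbT.
Qed.

Variables m n : nat.
Implicit Type D : {set 'I_m * 'I_n}.

Lemma mem_ferrers D i j : ferrers D -> ((i, j) \in D) = (i < col_dots D j).
Proof.
case=> up _ _ _; rewrite /col_dots -mem_initial_segment ?inE //.
move=> {}i i' le_i'i; rewrite !inE; have [k] := ubnP (i - i').
elim: k => // k IHk in i i' le_i'i *.
move=> lt_k ijD; have [eq_i|lt_i] := eqVneq (i : nat) i'.
  by rewrite -(val_inj eq_i).
have lt_pm : i.-1 < m by apply: leq_ltn_trans (leq_pred _) (ltn_ord i).
apply: (IHk (Ordinal lt_pm)) => /=; try lia.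
by apply: up ijD => /=; lia.
Qed.

(** Counting goes by columns; truncated subtraction gives 0 for a column that ends above row [t]. *)
Lemma dots_outsideE D delta t : ferrers D ->
  dots_outside D delta t =
    \sum_(j < n | j + (delta - 1 - t) < n) (col_dots D j - t).
Proof.
move=> ferrD; rewrite /dots_outside -sum1dep_card big_mkcond /=.
transitivity (\sum_(i < m) \sum_(j < n)
    (((i, j) \in D) && ((t <= i) && (j + (delta - 1 - t) < n)) : nat)).
  by rewrite pair_bigA; apply: eq_bigr => -[i j] _ /=; case: ifP.
rewrite exchange_big [RHS]big_mkcond /=; apply: eq_bigr => j _.
case: ifP => jn; last by rewrite big1 // => i _; rewrite !andbF.
have le_m : col_dots D j <= m by rewrite -[X in _ <= X]card_ord max_card.
rewrite -(sum_ord_window t le_m); apply: eq_bigr => i _.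
by rewrite mem_ferrers // andbT andbC.
Qed.

End Counting.

(** * The diagram of the theorem: its dot counts and a code on it *)

Section StaircaseDiagram.

Variables (m e d w : nat) (z : nat -> nat).
Local Notation s := (e + d).
Local Notation n := (w + s).+1.
Local Notation P := (\sum_(i < e.+1) z i).

(** In the notation of the theorem, [delta = d + 1], [y = s + 1] and [n = w + y]; columns [w] to
    [w + e] carry the sub-diagram of the [z i]. *)
Definition column_height (j : nat) : nat :=
  if j < w then d else if j <= w + e then d + z (j - w)
  else if j < w + s then s else m.

Variable D : {set 'I_m * 'I_n}.
Hypotheses (ferrersD : ferrers D)
  (heightD : forall j, col_dots D j = column_height j)
  (d_gt0 : 0 < d) (le_m : e + d.*2 <= m) (lt_w : d.+1 < w)
  (z_le : forall i, i <= e -> z i <= e) (z0_le : z 0 <= w).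

Local Notation k := (P + e * d + minn (m - s) (w + d)).

(** Here [r < d] keeps the last column out, and [i <= d] keeps the subtractions exact. *)
Lemma sum_column_height i r : i <= d -> r < d ->
  \sum_(j < w + (e.+1 + r)) (column_height j - i) =
    w * (d - i) + (e.+1 * (d - i) + P) + r * (s - i).
Proof.
move=> le_id lt_rd; rewrite big_split_ord big_split_ord /= addnA.
congr (_ + _ + _).
- rewrite (eq_bigr (fun=> d - i)) ?sum_nat_const ?card_ord // => j _.
  by rewrite /column_height ltn_ord.
- rewrite (eq_bigr (fun j : 'I__ => d - i + z j)) => [|j _].
    by rewrite big_split /= sum_nat_const card_ord.
  rewrite /column_height ltnNge leq_addr /= leq_add2l -ltnS ltn_ord addKn.
  by rewrite addnBAC.
- rewrite (eq_bigr (fun=> s - i)) ?sum_nat_const ?card_ord // => j _.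
  rewrite /column_height; have lt_j := ltn_ord j.
  case: ifP => [|_]; first by lia.
  case: ifP => [|_]; first by lia.
  by case: ifP => //; lia.
Qed.

(** For [i < d] the last column is discarded and [i] columns of height [s] remain; for [i = d] no
    column is discarded. *)
Lemma dots_outside_staircase i : i <= d ->
  dots_outside D d.+1 i =
    P + e * d + (if i < d then (d - i) * (w + 1 + i) else m - s).
Proof.
move=> le_id; rewrite dots_outsideE //.
have trunc r : r <= n -> d.+1 - 1 - i = n - r ->
    \sum_(j < n | j + (d.+1 - 1 - i) < n) (col_dots D j - i) =
    \sum_(j < r) (column_height j - i).
  move=> le_rn def_r.
  rewrite (big_ord_widen n (fun j => column_height j - i) le_rn).
  by apply: eq_big => [j|j _]; rewrite ?heightD // def_r; lia.
case: ltnP => [lt_id|ge_id].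
  rewrite (trunc (w + (e.+1 + i))); [|lia|lia].
  rewrite sum_column_height //.
  have [t ->] : exists t, d = i + t by exists (d - i); lia.
  have -> : i + t - i = t by lia.
  have -> : e + (i + t) - i = e + t by lia.
  by ring.
have Di : i = d by lia.
rewrite (trunc n); [|lia|lia].
rewrite big_ord_recr [X in _ + X]/= {2}/column_height.
have -> : w + s = w + (e.+1 + d.-1) by lia.
rewrite sum_column_height //; last by lia.
case: ifP => [|_]; first by move=> /=; lia.
case: ifP => [|_]; first by move=> /=; lia.
case: ifP => [|_]; first by move=> /=; lia.
rewrite /= Di subnn !muln0 !add0n -!addnA addnK; congr (_ + _).
have -> : m - d = e + (m - s) by lia.
by rewrite addnA -mulSnr prednK // mulnC.
Qed.

(** Only the last two terms compete: over [i < d], the product [(d - i) * (w + 1 + i)] is least at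
    [i = d - 1], where it equals [w + d]. *)
Lemma min_dots_staircase : min_dots_outside D d.+1 = k.
Proof.
have outE (i : 'I_d.+1) := dots_outside_staircase (ltnSE (ltn_ord i)).
have k_le i : i <= d -> k <= dots_outside D d.+1 i.
  move=> le_id; rewrite dots_outside_staircase // leq_add2l geq_min.
  case: ltnP => lt_id; rewrite ?leqnn //; apply/orP; right.
  have [t ->] : exists t, d = i + t.+1 by exists (d - i).-1; lia.
  rewrite -addnA addKn; nia.
have [i0 i0P] : exists i0 : 'I_d.+1, dots_outside D d.+1 i0 = k.
  have [le_m'|gt_m'] := leqP (m - s) (w + d).
    by exists ord_max; rewrite outE /= ltnn.
  have lt_pd : d.-1 < d.+1 by lia.
  exists (Ordinal lt_pd); rewrite outE /= prednK // leqnn.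
  congr (_ + _).
  have -> : d - d.-1 = 1 by lia.
  by lia.
apply: (bigminn_eq (i0 := i0)) => // [|i]; first exact: k_le.
exact: k_le (ltnSE (ltn_ord i)).
Qed.

(** The parameter space has dimension [(e + 1) * s + w]. The columns cost [(e + 1) * e - P]
    conditions and the tail costs [w + d - (m - s)], truncated at 0, so at least [k] dimensions are
    left. *)
Lemma staircase_code (K : finFieldType) :
  exists C : {vspace 'M[K]_(m, n)}, ferrers_code D k d.+1 C.
Proof.
have [L dimL] : exists L : fieldExtType K, \dim {:L} = s.
  by apply: fieldExt_of_dim; lia.
have [M dimM] : exists M : fieldExtType K, \dim {:M} = w.
  by apply: fieldExt_of_dim; lia.
have b0 : ((vbasis {:L})`_0 != 0)%R by rewrite vbasis0_neq0 ?dimL; lia.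
have [|bt bt_basis] := @annih_basis K L s.-1 _ b0; first by rewrite dimL; lia.
rewrite prednK in bt_basis; last by lia.
pose X : vectType K := (L * {ffun 'I_e -> L} * M)%type.
have dimX : \dim {:X} = s + e * s + w.
  rewrite dimvf -[LHS]/(dim L + #|'I_e| * dim L + dim M) card_ord.
  by rewrite -!dimvf dimL dimM.
pose phi (t : nat * nat + nat) (x : X) : K := match t with
  | inl (i, l) => coordn l (inner_val x i)
  | inr l => tail_entry d l x end.
(* The first conditions cut column [w + i] down to height [d + z i]; the others kill the tail
   entries that do not fit into the [m] rows. *)
pose ts : seq (nat * nat + nat) :=
  [seq inl (i, l) | i <- iota 0 e.+1, l <- iota (d + z i) (e - z i)] ++
  [seq inr l | l <- iota (m - s) (w + d - (m - s))].
have phi_scalar t : scalar (phi t).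
  case: t => [[i l]|l] c x y /=; last exact: tail_entry_scalar.
  by rewrite inner_val_linear linearP.
have [U dimU U0] := common_zeros_dim ts phi_scalar.
have size_ts : size ts + P = e.+1 * e + (w + d - (m - s)).
  rewrite size_cat size_allpairs_dep size_map size_iota addnAC; congr (_ + _).
  rewrite sumnE big_map -[iota 0 _]/(index_iota 0 e.+1) big_mkord -big_split /=.
  rewrite (eq_bigr (fun=> e)) ?sum_nat_const ?card_ord // => i _.
  by rewrite size_iota subnK // z_le // -ltnS.
have le_k : k <= \dim U by rewrite dimX in dimU; nia.
have [W sWU dimW] := subspace_of_dim le_k.
have inner0 x i l : x \in U -> i <= e -> d + z i <= l ->
    coordn l (inner_val x i) = 0%R.
  move=> /U0/allP x0 le_ie le_l; have [lt_ls|] := ltnP l s; last first.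
    by move=> ?; rewrite coordn_out ?dimL.
  apply/eqP/(x0 (inl (i, l))); rewrite mem_cat; apply/orP; left.
  by apply/allpairsPdep; exists i, l; split=> //; rewrite mem_iota; lia.
have tail0 x l : x \in U -> m - s <= l -> tail_entry d l x = 0%R.
  move=> xU le_l; have [lt_l|ge_l] := ltnP l (w + d).
    move: xU => /U0/allP x0; apply/eqP/(x0 (inr l)); rewrite mem_cat.
    by apply/orP; right; apply/mapP; exists l => //; rewrite mem_iota; lia.
  (* Here [z 0 <= w] enters: column [w] has height [d + z 0], so from [w + d] on neither the value
     at b_0 nor the shifted [x.2] has a nonzero coordinate. *)
  rewrite /tail_entry inner0 //; last by lia.
  case: ifP => _; rewrite ?subr0 // coordn_out ?subr0 // dimM; lia.
pose E : {linear X -> 'M[K]_(m, n)} := HB.pack (@codeword K L M e d w bt m)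
  (GRing.isLinear.Build _ _ _ _ _ (@codeword_linear K L M e d w bt m)).
have rankE x : x \in W -> x != 0%R -> d < \rank (E x).
  move=> /(subvP sWU) xU; apply: rank_codeword => //; [lia | lia | move=> l].
  exact: tail0.
exists (linfun E @: W)%VS; split.
(* The rank bound also makes the encoding injective on [W]: a nonzero [x] cannot give the zero
   matrix. *)
- rewrite limg_dim_eq //; apply/eqP; rewrite -subv0; apply/subvP=> x.
  rewrite memv_cap memv_ker lfunE memv0 => /andP[xW /eqP Ex0].
  by apply: contraT => /(rankE x xW); rewrite Ex0 mxrank0.
- move=> _ /memv_imgP[x /(subvP sWU) xU ->] i j; rewrite lfunE /= mxE.
  rewrite mem_ferrers // heightD -leqNgt /column_height /entry.
  case: ifP => lt_jw; first by move=> /leq_gtF->.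
  case: ifP => le_jwe.
    move=> le_i; have -> : j < w + s by lia.
    by apply: inner0 => //; lia.
  case: ifP => lt_jws le_i; first by rewrite coordn_out ?dimL.
  by have := ltn_ord i; rewrite ltnNge le_i.
- move=> _ /memv_imgP[x xW ->]; rewrite lfunE => Ex0; apply: rankE => //.
  by apply: contraNneq Ex0 => ->; rewrite linear0.
Qed.

End StaircaseDiagram.

Theorem theorem4p9 (K : finFieldType) (m n delta y : nat) (z : nat -> nat)
    (D : {set 'I_m * 'I_n})
    (m_gt0 : 0 < m) (n_gt0 : 0 < n) (delta_gt0 : 0 < delta) (y_gt0 : 0 < y)
    (le_delta_y : delta <= y)
    (le_y_m : y + delta <= m + 2) (le_y_n : y + delta + 1 <= n)
    (z_mono : forall i, i < y - delta -> z i <= z i.+1)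
    (z_max : z (y - delta) <= y - delta)
    (ferrersD : ferrers D)
    (col_left : forall j : 'I_n, j <= n - y - 1 -> col_dots D j = delta - 1)
    (col_mid : forall (j : 'I_n) (i : nat), i <= y - delta ->
       j = n - y + i :> nat -> col_dots D j = delta - 1 + z i)
    (col_right : forall j : 'I_n, n - delta + 1 <= j <= n - 2 ->
       col_dots D j = y - 1)
    (col_last : forall j : 'I_n, j = n - 1 :> nat -> col_dots D j = m)
    (le_z0 : z 0 <= n - y) :
  let P := \sum_(i < (y - delta).+1) z i in
  let k := if m + 2 <= n + delta
           then (m + 1 - y) + (y - delta) * (delta - 1) + P
           else (n - 1) + (y - delta) * (delta - 2) + P in
  exists C : {vspace 'M[K]_(m, n)}, optimal_ferrers_code D k delta C.
Proof.
have [d Dd] : exists d, delta = d.+1 by exists delta.-1; lia.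
have [e De] : exists e, y = (e + d).+1 by exists (y - delta); lia.
have [w Dw] : exists w, n = (w + (e + d)).+1 by exists (n - y); lia.
subst n y delta.
(* For [delta = 1] column 0 would be empty although row 0 is full. *)
have d_gt0 : 0 < d.
  rewrite lt0n; apply/negP=> /eqP d0.
  have [_ _ /(_ (Ordinal m_gt0) erefl) row0 _] := ferrersD.
  have: (Ordinal m_gt0, ord0) \in D.
    have: [set j | (Ordinal m_gt0, j) \in D] == setT.
      rewrite eqEcard subsetT cardsT card_ord /=.
      by have := row0; rewrite /row_dots => ->.
    by move/eqP/setP/(_ ord0); rewrite !inE.
  by rewrite mem_ferrers // col_left //= d0.
have De : (e + d).+1 - d.+1 = e by lia.
have Dd : d.+1 - 1 = d by lia.
have Dw : (w + (e + d)).+1 - (e + d).+1 = w by lia.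
rewrite De Dd Dw in z_mono z_max col_left col_mid le_z0 *.
have z_homo i r : i + r <= e -> z i <= z (i + r).
  elim: r => [|r IHr] le_e; first by rewrite addn0.
  by apply: leq_trans (IHr _) _; rewrite ?addnS ?z_mono; lia.
have z_le i : i <= e -> z i <= e.
  move=> le_ie; apply: leq_trans z_max; have := z_homo i (e - i).
  by rewrite subnKC //; apply.
have heightD j : col_dots D j = column_height m e d w z j.
  rewrite /column_height; have lt_j := ltn_ord j.
  have [lt_jw|ge_jw] := ltnP j w; first by apply: col_left; lia.
  have [le_j|gt_j] := leqP j (w + e); first by rewrite (col_mid j (j - w)); lia.
  have [lt_js|ge_js] := ltnP j (w + (e + d)); first by rewrite col_right; lia.
  by apply: col_last; lia.
have [le_m lt_w] : e + d.*2 <= m /\ d.+1 < w by lia.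
have [C codeC] := staircase_code ferrersD heightD d_gt0 le_m lt_w z_le le_z0 K.
move=> P k; have Dk : k = P + e * d + minn (m - (e + d)) (w + d).
  (* The test amounts to [m - (e + d) <= w + d]. If it fails, [n - 1 = e + (w + d)], whose [e] makes
     up for the factor [delta - 2 = d - 1]. *)
  rewrite /k; case: ifP => cond.
    by rewrite (minn_idPl _); lia.
  by rewrite (minn_idPr _); nia.
exists C; split; first by rewrite Dk.
by rewrite Dk (min_dots_staircase ferrersD heightD); lia.
Qed.
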